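(* Let $f:[a,b]\to\mathbb{R}$ be such that $f'_g(t)=0$ for all $t\in[a,b]$. Then $$f(t)=f(s)\quad\text{for all } s,t\in I,\quad I\in\mathcal{I}_2.$$
   Context: Let $a<b$ be real numbers and let $g:\mathbb{R}\to\mathbb{R}$ be non-decreasing and left-continuous (a ''derivator''). Put $\Delta g(t)=g(t^+)-g(t)$, $D_g=\{t\in\mathbb{R}:\Delta g(t)>0\}$, and $C_g=\{t\in\mathbb{R}: g \text{ is constant on } (t-\varepsilon,t+\varepsilon)\text{ for some }\varepsilon>0\}$. The set $C_g$ is open; write $C_g=\bigcup_n (a_n,b_n)$ with $(a_n,b_n)$ its (pairwise disjoint) connected components. Put $N_g^-=\{a_n\}_n\setminus D_g$, $N_g^+=\{b_n\}_n\setminus D_g$. Standing assumption: $a\notin N_g^-$ and $b\notin N_g^+\cup D_g\cup C_g$. $g$-derivative: for $f:[a,b]\to\mathbb{R}$ and $t\in[a,b]$, $f'_g(t)=\lim_{s\to t}\frac{f(s)-f(t)}{g(s)-g(t)}$ if $t\notin D_g\cup C_g$; $f'_g(t)=\lim_{s\to t^+}\frac{f(s)-f(t)}{g(s)-g(t)}$ if $t\in D_g$; $f'_g(t)=\lim_{s\to b_n^+}\frac{f(s)-f(b_n)}{g(s)-g(b_n)}$ if $t\in(a_n,b_n)\subset C_g$; provided the limit exists (and is finite). Limits are taken over those $s\in[a,b]$ for which the denominator is nonzero. $\mathcal{I}_2$ denotes the family of (nonempty) connected subsets of $[a,b]\setminus(C_g\cup N_g^+\cup D_g)$. *)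

(* Defs.v *)
From HB Require Import structures.
From mathcomp Require Import all_boot all_order all_algebra.
From mathcomp Require Import all_classical all_reals all_analysis.
Set Implicit Arguments.
Unset Strict Implicit.
Unset Printing Implicit Defensive.
Import Order.TTheory GRing.Theory Num.Theory.
Import numFieldNormedType.Exports.
Local Open Scope classical_set_scope.
Local Open Scope ring_scope.

Definition derivator (R : realType) (g : R -> R) : Prop :=
  {homo g : x y / x <= y} /\ (forall t, g s @[s --> t^'-] --> g t).

Definition Delta (R : realType) (g : R -> R) (t : R) : R :=
  lim (g s @[s --> t^'+]) - g t.

Definition Dset (R : realType) (g : R -> R) : set R :=
  [set t | 0 < Delta g t].

Definition Cset (R : realType) (g : R -> R) : set R :=
  [set t | exists2 e : R, 0 < e &
           exists c : R, forall s, s \in `]t - e, t + e[ -> g s = c].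

(* Endpoints of a component of C_g may be infinite, hence [\bar R]. *)
Definition Ccomponent (R : realType) (g : R -> R) (u v : \bar R) : Prop :=
  exists2 t, Cset g t &
    connected_component (Cset g) t = [set x : R | (u < x%:E)%E /\ (x%:E < v)%E].

Definition Nminus (R : realType) (g : R -> R) : set R :=
  [set x : R | exists v : \bar R, Ccomponent g x%:E v] `\` Dset g.

Definition Nplus (R : realType) (g : R -> R) : set R :=
  [set x : R | exists u : \bar R, Ccomponent g u x%:E] `\` Dset g.

(* The points s of [a, b] at which the quotient based at x makes sense. *)
Definition gquot_dom (R : realType) (g : R -> R) (a b x : R) : set R :=
  [set s | s \in `[a, b] /\ g s - g x != 0].

Definition gquot (R : realType) (g f : R -> R) (x s : R) : R :=
  (f s - f x) / (g s - g x).

(* [is_gderiv g a b f t l]: the g-derivative of f at t exists and equals l.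
   A function [a, b] -> R is represented by any f : R -> R extending it; for t
   in [a, b] and under the conditions on a and b in [good_endpoints], only
   values of f on [a, b] are used, and each filter below is proper, so l is
   unique. The three cases are mutually exclusive and exhaustive, except that
   there is no g-derivative on a component of C_g unbounded above (such a
   component cannot meet [a, b] under [good_endpoints]). *)
Definition is_gderiv (R : realType) (g : R -> R) (a b : R) (f : R -> R)
    (t l : R) : Prop :=
  [\/ ~ (Dset g `|` Cset g) t /\
      gquot g f t s @[s --> within (gquot_dom g a b t) t^'] --> l,
      Dset g t /\
      gquot g f t s @[s --> within (gquot_dom g a b t) t^'+] --> l |
      exists (u : \bar R) (bn : R),
        [/\ Ccomponent g u bn%:E, (u < t%:E)%E, t < bn &
            gquot g f bn s @[s --> within (gquot_dom g a b bn) bn^'+] --> l]].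

Definition good_endpoints (R : realType) (g : R -> R) (a b : R) : Prop :=
  ~ Nminus g a /\ ~ (Nplus g `|` Dset g `|` Cset g) b.

Definition I2 (R : realType) (g : R -> R) (a b : R) : set (set R) :=
  [set I | [/\ I !=set0, connected I &
               I `<=` `[a, b] `\` (Cset g `|` Nplus g `|` Dset g)]].

(* Main.v *)
Require Import Defs.
From HB Require Import structures.
From mathcomp Require Import all_boot all_order all_algebra.
From mathcomp Require Import all_classical all_reals all_analysis.
From mathcomp Require Import lra.
Import Order.TTheory GRing.Theory Num.Theory.
Import numFieldNormedType.Exports.
Local Open Scope classical_set_scope.
Local Open Scope ring_scope.

(** On [I] the [g]-derivative is a genuine two-sided limit: no point of [I] is
    in [D_g], where only right limits are taken, nor in [C_g], where the base
    point is moved to the end of the component. Since [I] is an interval that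
    misses [C_g], [g] is moreover strictly increasing on it
    ([derivator_injective_off_Cset]), so near each [x] of [I] every other point
    of [I] is admitted in the limit. Hence a zero [g]-derivative gives
    [|f y - f x| <= e |g y - g x|] for [y] in [I] close to [x], for any [e > 0]
    ([gderiv0_local_bound]). A supremum argument as in the classical mean value
    inequality makes this local bound global ([le_increment_of_local]):
    [|f t - f s| <= e (g t - g s)] for [s <= t] in [I]; let [e] tend to [0]. *)

(** The points of [[s, t]] reachable from [s] with the desired bound have a
    supremum [c]. The local bound at [c] used on its left puts [c] among them,
    and used on its right pushes further unless [c = t]. The bounds chain
    because increments of the monotone [G] add up without cancellation. *)
Lemma le_increment_of_local {R : realType} (F G : R -> R) (s t : R) :
  s <= t -> {homo G : x y / x <= y} ->
  (forall x, x \in `[s, t] ->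
    \forall y \near x, y \in `[s, t] -> `|F y - F x| <= `|G y - G x|) ->
  `|F t - F s| <= G t - G s.
Proof.
move=> st homoG Floc.
pose A := [set y | y \in `[s, t] /\ `|F y - F s| <= G y - G s].
have As : A s by split; rewrite ?subrr ?normr0 // in_itv /= lexx.
have ubA : ubound A t by move=> y [/itvP ->].
have supA : has_sup A by split; [exists s | exists t].
pose c := sup A.
have sc : s <= c by apply: ub_le_sup => //; exists t.
have ct : c <= t by apply: ge_sup => //; exists s.
have cst : c \in `[s, t] by rewrite in_itv /= sc.
have [d /= d0 locd] := Floc _ cst.
have dist_trans (x y z : R) : `|F x - F z| <= `|F x - F y| + `|F y - F z|.
  by rewrite -[F x - F z](subrKA (F y)) ler_normD.
have Ac : A c.
  split=> //.
  have [y [yst yA] ydc] := sup_adherent d0 supA.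
  have yc : y <= c by apply: ub_le_sup => //; exists t.
  have := locd y; rewrite /ball_ /= ger0_norm ?subr_ge0// => /(_ _ yst).
  have -> : c - y < d by rewrite -/c in ydc; lra.
  have Gyc := homoG _ _ yc.
  rewrite distrC [`|G y - _|]distrC [`|G c - _|]ger0_norm ?subr_ge0// => /(_ isT).
  by have := dist_trans c y s; lra.
have [tc|ltct] := leP t c.
  have -> : t = c by apply/le_anti/andP.
  by case: Ac.
pose z := Num.min t (c + d / 2).
have cz : c < z by rewrite lt_min ltct /=; lra.
have zt : z <= t by rewrite ge_min lexx.
have zcd : z <= c + d / 2 by rewrite ge_min lexx orbT.
have zst : z \in `[s, t] by rewrite in_itv /= zt; lra.
have Az : A z.
  split=> //.
  have := locd z; rewrite /ball_ /= distrC gtr0_norm ?subr_gt0// => /(_ _ zst).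
  have -> : z - c < d by lra.
  rewrite [`|G z - _|]ger0_norm ?subr_ge0 ?homoG ?(ltW cz)// => /(_ isT).
  by case: Ac => _; have := dist_trans z c s; lra.
by have : z <= c; [apply: ub_le_sup => //; exists t | rewrite leNgt cz].
Qed.

(** Equal values at two points force a monotone [g] to be constant between
    them, hence near their midpoint. *)
Lemma derivator_injective_off_Cset {R : realType} (g : R -> R) (s t : R) :
  {homo g : x y / x <= y} -> (forall x, x \in `[s, t] -> ~ Cset g x) ->
  {in `[s, t] &, injective g}.
Proof.
move=> homog nC x y.
wlog xy : x y / x < y => [wlt|].
  by have [/wlt|/wlt H xst yst /esym /H -> //|//] := ltgtP x y.
rewrite !in_itv /= => /andP[sx xt] /andP[sy yt] gxy.
case: (nC ((x + y) / 2)); first by rewrite in_itv /=; lra.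
exists ((y - x) / 2); first by lra.
exists (g x) => z; rewrite in_itv /= => /andP[z1 z2].
have xz : x <= z by lra.
have zy : z <= y by lra.
by apply/le_anti; rewrite {1}gxy !homog.
Qed.

Lemma Ccomponent_subset {R : realType} (g : R -> R) (u v : \bar R) (x : R) :
  Ccomponent g u v -> (u < x%:E)%E -> (x%:E < v)%E -> Cset g x.
Proof.
case=> y _ compE ux xv.
apply: (@connected_component_sub _ _ y).
by rewrite compE.
Qed.

(** The limit only sees points [y] with [g y != g x]; the last premise on [y]
    rules out the remaining ones, where [f] could differ from [f x]. *)
Lemma gderiv0_local_bound {R : realType} (g f : R -> R) (a b x e : R) :
  ~ (Dset g `|` Cset g) x -> is_gderiv g a b f x 0 -> 0 < e ->
  \forall y \near x, y \in `[a, b] -> (g y = g x -> y = x) ->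
    `|f y - f x| <= e * `|g y - g x|.
Proof.
move=> xDC [[_ fx0]|[Dx _]|[u [v [uv ux xv _]]]] e0.
- have : \forall y \near within (gquot_dom g a b x) x^',
      `|gquot g f x y| < e.
    by move/cvgr0_norm_lt: fx0; apply.
  rewrite !near_withinE; apply: filterS => y qlt yab ginj.
  have [->|yx] := eqVneq y x; first by rewrite !subrr normr0 mulr0.
  have gyx : g y - g x != 0.
    by rewrite subr_eq0; apply: contra_neq yx.
  have := qlt yx (conj yab gyx).
  by rewrite /gquot normrM normfV ltr_pdivrMr ?normr_gt0// => /ltW.
- by case: xDC; left.
- by case: xDC; right; apply: (@Ccomponent_subset _ _ u v%:E).
Qed.

Theorem corollary3p19 (R : realType) (a b : R) (g f : R -> R)
    (hab : a < b) (hg : derivator g) (hends : good_endpoints g a b)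
    (hf : forall t : R, t \in `[a, b] -> is_gderiv g a b f t 0) :
  forall I : set R, I2 g a b I ->
  forall s t : R, I s -> I t -> f t = f s.
Proof.
move=> I [_ /connected_intervalP itvI subI] s t.
wlog st : s t / s <= t => [wle Is It|].
  by have [/wle|/ltW/wle H] := leP s t; [apply | rewrite H].
move=> Is It; case: hg => homog _.
have stI x : x \in `[s, t] -> I x.
  by rewrite in_itv => xst; apply: (itvI s t).
have stab x : x \in `[s, t] -> x \in `[a, b] by move=> /stI/subI[].
have stDC x : x \in `[s, t] -> ~ (Dset g `|` Cset g) x.
  by move=> /stI/subI[_ nx] [Dx|Cx]; apply: nx; [right | left; left].
have injg : {in `[s, t] &, injective g}.
  by apply: derivator_injective_off_Cset => // x /stDC nx Cx; apply: nx; right.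
have bound e : 0 < e -> `|f t - f s| <= e * g t - e * g s.
  move=> e0; apply: (@le_increment_of_local _ f (fun x => e * g x)) => //.
    by move=> x y xy; rewrite ler_pM2l// homog.
  move=> x xst; have := gderiv0_local_bound _ _ _ _ _ _ (stDC x xst) (hf x (stab x xst)) e0.
  apply: filterS => y fy yst; rewrite -mulrBr normrM (gtr0_norm e0).
  by apply: fy (stab y yst) _; apply: injg.
have gst := homog _ _ st.
apply/eqP; rewrite -subr_eq0 -normr_le0; apply/ler_addgt0Pr => e e0.
(* the summand 1 keeps the denominator positive when g s = g t *)
have d0 : 0 < g t - g s + 1 by lra.
apply: (le_trans (bound (e / (g t - g s + 1)) (divr_gt0 e0 d0))).
by rewrite -mulrBr add0r -mulrA ler_piMr ?(ltW e0)// mulrC ler_pdivrMr //; lra.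
Qed.
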